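(* Let $T = \Bbbk[a,b] \rtimes \Gamma$, where $\Gamma$ acts on $\Bbbk[a,b]$ so that $t^\nu p(a,b) = p(a+\nu, b)\, t^\nu$ for $\nu \in \Gamma$, $p \in \Bbbk[a,b]$. The linear map $\phi: W_\Gamma \to T$, $\phi(e_\mu) = (a + b\mu)\, t^\mu$ for $\mu\in\Gamma$, induces an anti-homomorphism of algebras $\Phi: U(W_\Gamma) \to T$. Consequently, $T$ is a left $U(W_\Gamma)$-module via \[ e_\mu . \big(p(a,b)\, t^\nu\big) = (a + \nu + b\mu)\, p(a,b)\, t^{\mu+\nu}, \qquad \mu,\nu \in \Gamma,\ p\in \Bbbk[a,b]. \]
   Context: $\Bbbk$ is an algebraically closed field of characteristic zero and $\Gamma$ is a finitely generated additive subgroup of $\Bbbk$. $W_\Gamma$ is the Lie algebra over $\Bbbk$ with basis $\{e_\nu \mid \nu \in \Gamma\}$ and bracket $[e_\mu, e_\nu] = (\nu - \mu) e_{\nu+\mu}$; $U(W_\Gamma)$ is its universal enveloping algebra. $\Bbbk[a,b]$ is the commutative polynomial ring, and $\Bbbk[a,b]\rtimes\Gamma = \bigoplus_{\gamma\in\Gamma}\Bbbk[a,b]t^\gamma$ as a vector space, with $t^\gamma t^\delta = t^{\gamma+\delta}$ and the stated commutation rule. *)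

(* Defs.v *)
From HB Require Import structures.
From mathcomp Require Import all_boot all_order all_algebra.
From mathcomp Require Import generic_quotient ring_quotient finmap boolp ring.
From mathcomp.multinomials Require Import mpoly monalg.

Set Implicit Arguments.
Unset Strict Implicit.
Unset Printing Implicit Defensive.

Import GRing.Theory.
Local Open Scope ring_scope.
Local Open Scope quotient_scope.

(* mpoly and monalg both define the next notation. *)
Local Notation "g @_ k" := (monalg.mcoeff k g) : ring_scope.

(* [{malg G[K]}] (monalg) is the group of finitely supported functions K -> G;
   [<< x *g i >>] is the function with value x at i and 0 elsewhere. *)

(* Locked, as unification otherwise unfolds these sums. *)
HB.lock Definition biext (K : choiceType) (G V : zmodType)
    (F : K -> K -> G -> G -> V) (f g : {malg G[K]}) : V :=
  \sum_(i <- msupp f) \sum_(j <- msupp g) F i j f@_i g@_j.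
Canonical biext_unlockable := Unlockable biext.unlock.

Section MalgExtra.
Variables (K : choiceType) (G : zmodType).

Lemma malg_ind (P : {malg G[K]} -> Prop) :
    P 0 -> (forall f g, P f -> P g -> P (f + g)) ->
    (forall i x, P << x *g i >>) ->
  forall f, P f.
Proof. by move=> P0 PD PU f; rewrite [f]monalgE; apply: big_ind. Qed.

Lemma zmod_morphism_addD (U V : zmodType) (f : U -> V) :
  zmod_morphism f -> {morph f : x y / x + y}.
Proof.
move=> fB x y; have f0 : f 0 = 0 by rewrite -(subrr 0) fB subrr.
by rewrite -{1}[y]opprK fB -[- y]sub0r fB f0 sub0r opprK.
Qed.

Section BiadditiveExtension.
Variables (V : zmodType) (F : K -> K -> G -> G -> V).
Hypothesis Fl : forall i j y, zmod_morphism ((F i j)^~ y).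
Hypothesis Fr : forall i j x, zmod_morphism (F i j x).

Let F0l i j y : F i j 0 y = 0.
Proof. by rewrite -(subrr 0) Fl subrr. Qed.

Let F0r i j x : F i j x 0 = 0.
Proof. by rewrite -(subrr 0) Fr subrr. Qed.

Lemma biextw (d e : {fset K}) (f g : {malg G[K]}) :
    (msupp f `<=` d)%fset -> (msupp g `<=` e)%fset ->
  biext F f g = \sum_(i <- d) \sum_(j <- e) F i j f@_i g@_j.
Proof.
move=> fd ge; rewrite unlock (big_fset_incl _ fd) /=; last first.
  by move=> i _ /mcoeff_outdom ->; apply: big1 => j _; apply: F0l.
apply: eq_bigr => i _; rewrite (big_fset_incl _ ge) //= => j _.
by move=> /mcoeff_outdom ->.
Qed.

Lemma biext_is_additivel g : zmod_morphism (biext F ^~ g).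
Proof.
move=> f1 f2; set d := (msupp f1 `|` msupp f2)%fset.
have d1 : (msupp f1 `<=` d)%fset by apply: fsubsetUl.
have d2 : (msupp f2 `<=` d)%fset by apply: fsubsetUr.
rewrite (biextw d1 (fsubset_refl _)) (biextw d2 (fsubset_refl _)).
rewrite (biextw (msuppB_le f1 f2) (fsubset_refl _)) -sumrB.
by apply: eq_bigr => i _; rewrite -sumrB; apply: eq_bigr => j _; rewrite mcoeffB Fl.
Qed.

Lemma biext_is_additiver f : zmod_morphism (biext F f).
Proof.
move=> g1 g2; set d := (msupp g1 `|` msupp g2)%fset.
have d1 : (msupp g1 `<=` d)%fset by apply: fsubsetUl.
have d2 : (msupp g2 `<=` d)%fset by apply: fsubsetUr.
rewrite (biextw (fsubset_refl _) d1) (biextw (fsubset_refl _) d2).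
rewrite (biextw (fsubset_refl _) (msuppB_le g1 g2)) -sumrB.
by apply: eq_bigr => i _; rewrite -sumrB; apply: eq_bigr => j _; rewrite mcoeffB Fr.
Qed.

Lemma biextUU i j x y : biext F << x *g i >> << y *g j >> = F i j x y.
Proof.
rewrite (biextw msuppU_le msuppU_le) !big_seq_fset1.
by rewrite !mcoeffUU.
Qed.

Lemma biext0l g : biext F 0 g = 0.
Proof. by have := biext_is_additivel g 0 0; rewrite /= !subrr. Qed.

Lemma biext0r f : biext F f 0 = 0.
Proof. by have := biext_is_additiver f 0 0; rewrite !subrr. Qed.

Lemma biextDl g : {morph (biext F)^~ g : x y / x + y}.
Proof. exact/zmod_morphism_addD/biext_is_additivel. Qed.

Lemma biextDr f : {morph biext F f : x y / x + y}.
Proof. exact/zmod_morphism_addD/biext_is_additiver. Qed.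

End BiadditiveExtension.
End MalgExtra.

Section BilinearExtension.
Variables (K : choiceType) (R : nzRingType) (V : lmodType R).
Variable F : K -> K -> R -> R -> V.
Hypothesis Fl : forall i j y, zmod_morphism ((F i j)^~ y).
Hypothesis Fr : forall i j x, zmod_morphism (F i j x).
Hypothesis FZl : forall i j c x y, F i j (c * x) y = c *: F i j x y.
Hypothesis FZr : forall i j c x y, F i j x (c * y) = c *: F i j x y.

Lemma biext_is_linearl g : linear (fun f : {malg R[K]} => biext F f g).
Proof.
move=> c f1 f2; rewrite (biextDl Fl) //; congr (_ + _).
rewrite (biextw Fl Fr (msuppZ_le c f1) (fsubset_refl _)).
rewrite (biextw Fl Fr (fsubset_refl (msupp f1)) (fsubset_refl _)) scaler_sumr.
apply: eq_bigr => i _; rewrite scaler_sumr; apply: eq_bigr => j _.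
by rewrite mcoeffZ FZl.
Qed.

Lemma biext_is_linearr f : linear (fun g : {malg R[K]} => biext F f g).
Proof.
move=> c g1 g2; rewrite (biextDr Fl) //; congr (_ + _).
rewrite (biextw Fl Fr (fsubset_refl _) (msuppZ_le c g1)).
rewrite (biextw Fl Fr (fsubset_refl _) (fsubset_refl (msupp g1))) scaler_sumr.
apply: eq_bigr => i _; rewrite scaler_sumr; apply: eq_bigr => j _.
by rewrite mcoeffZ FZr.
Qed.
End BilinearExtension.

HB.mixin Record Lmodule_isLieAlgebra (k : fieldType) L of GRing.Lmodule k L := {
  lie : L -> L -> L;
  lie_linearl : forall y, linear (lie^~ y);
  lie_linearr : forall x, linear (lie x);
  lie_alternating : forall x, lie x x = 0;
  lie_jacobi : forall x y z,
    lie x (lie y z) + lie y (lie z x) + lie z (lie x y) = 0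
}.

#[short(type="lieAlgType")]
HB.structure Definition LieAlgebra (k : fieldType) :=
  {L of GRing.Lmodule k L & Lmodule_isLieAlgebra k L}.

Section GeneratedBiadditive.
Variables (V : zmodType) (S : V -> Prop) (op : V -> V -> V).
Hypothesis V_ind : forall P : V -> Prop,
  P 0 -> (forall f g, P f -> P g -> P (f + g)) -> (forall f, S f -> P f) ->
  forall f, P f.
Hypothesis opl : forall g, zmod_morphism (op^~ g).
Hypothesis opr : forall f, zmod_morphism (op f).

Let op0l g : op 0 g = 0.
Proof. by have := opl g 0 0; rewrite /= !subrr. Qed.
Let op0r f : op f 0 = 0.
Proof. by have := opr f 0 0; rewrite !subrr. Qed.
Let opDl f g h : op (f + g) h = op f h + op g h.
Proof. exact: (zmod_morphism_addD (opl h)). Qed.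
Let opDr f g h : op f (g + h) = op f g + op f h.
Proof. exact: (zmod_morphism_addD (opr f)). Qed.

Lemma gen_associative :
    (forall f g h, S f -> S g -> S h -> op f (op g h) = op (op f g) h) ->
  associative op.
Proof.
move=> SA f g h.
elim/V_ind: f => [|f1 f2 IH1 IH2|f Sf]; first by rewrite !op0l.
  by rewrite !opDl IH1 IH2.
elim/V_ind: g => [|g1 g2 IH1 IH2|g Sg]; first by rewrite op0l !op0r op0l.
  by rewrite opDl !opDr opDl IH1 IH2.
elim/V_ind: h => [|h1 h2 IH1 IH2|h Sh]; first by rewrite !op0r.
  by rewrite !opDr IH1 IH2.
exact: SA.
Qed.

Lemma gen_antisym :
    (forall f g, S f -> S g -> op f g + op g f = 0) ->
  forall f g, op f g + op g f = 0.
Proof.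
move=> SN f g.
elim/V_ind: f => [|f1 f2 IH1 IH2|f Sf]; first by rewrite op0l op0r addr0.
  by rewrite opDl opDr addrACA IH1 IH2 addr0.
elim/V_ind: g => [|g1 g2 IH1 IH2|g Sg]; first by rewrite op0l op0r addr0.
  by rewrite opDl opDr addrACA IH1 IH2 addr0.
exact: SN.
Qed.

Lemma gen_alternating :
    (forall f g, S f -> S g -> op f g + op g f = 0) ->
    (forall f, S f -> op f f = 0) ->
  forall f, op f f = 0.
Proof.
move=> SN S0 f; elim/V_ind: f => [|f g IHf IHg|f Sf]; first by rewrite op0l.
  by rewrite opDl !opDr IHf IHg add0r addr0 gen_antisym.
exact: S0.
Qed.

Lemma gen_jacobi :
    (forall f g h, S f -> S g -> S h ->
      op f (op g h) + op g (op h f) + op h (op f g) = 0) ->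
  forall f g h, op f (op g h) + op g (op h f) + op h (op f g) = 0.
Proof.
have sumD (a b c d e i : V) :
    a + b + c = 0 -> d + e + i = 0 -> (a + d) + (b + e) + (c + i) = 0.
  by move=> abc dei; rewrite (addrACA a) (addrACA (a + b)) abc dei addr0.
move=> SJ f g h.
elim/V_ind: f => [|f1 f2 IH1 IH2|f Sf]; first by rewrite !(op0l, op0r) !addr0.
  by rewrite !(opDl, opDr); apply: sumD.
elim/V_ind: g => [|g1 g2 IH1 IH2|g Sg]; first by rewrite !(op0l, op0r) !addr0.
  by rewrite !(opDl, opDr); apply: sumD.
elim/V_ind: h => [|h1 h2 IH1 IH2|h Sh]; first by rewrite !(op0l, op0r) !addr0.
  by rewrite !(opDl, opDr); apply: sumD.
exact: SJ.
Qed.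
End GeneratedBiadditive.

Inductive ideal_span (R : nzRingType) (P : R -> Prop) : R -> Prop :=
| IdealSpan0 : ideal_span P 0
| IdealSpanD u v : ideal_span P u -> ideal_span P v -> ideal_span P (u + v)
| IdealSpanM a r b : P r -> ideal_span P (a * r * b).

Lemma ideal_spanN (R : nzRingType) (P : R -> Prop) u :
  ideal_span P u -> ideal_span P (- u).
Proof.
elim=> [|{}u v _ Nu _ Nv|a r b Pr]; first by rewrite oppr0; apply: IdealSpan0.
  by rewrite opprD; apply: IdealSpanD.
by rewrite -!mulNr; apply: IdealSpanM.
Qed.

Lemma ideal_spanMM (R : nzRingType) (P : R -> Prop) u c d :
  ideal_span P u -> ideal_span P (c * u * d).
Proof.
elim=> [|{}u v _ Pu _ Pv|a r b Pr]; first by rewrite mulr0 mul0r; apply: IdealSpan0.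
  by rewrite mulrDr mulrDl; apply: IdealSpanD.
by rewrite !mulrA -mulrA -[c * a * r * (b * d)]/((c * a) * r * (b * d)); apply: IdealSpanM.
Qed.

Section UniversalEnveloping.
Variables (k : fieldType) (L : lieAlgType k).

(* The free associative unital algebra on the underlying set of L *)
Local Notation lie_free := {malg k[{fmonom L}]}.

Definition lie_gen (x : L) : lie_free := << fmu x >>.

(* Modulo the first family of relations [lie_free] is the tensor algebra
   of the vector space L. *)
Inductive uea_rel : lie_free -> Prop :=
| UeaLinear c x y : uea_rel (lie_gen (c *: x + y) - (c *: lie_gen x + lie_gen y))
| UeaBracket x y :
    uea_rel (lie_gen x * lie_gen y - lie_gen y * lie_gen x - lie_gen (lie x y)).

Definition uea_ideal : {pred lie_free} := fun u => `[< ideal_span uea_rel u >].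

Lemma uea_idealP (u : lie_free) : reflect (ideal_span uea_rel u) (u \in uea_ideal).
Proof. exact: asboolP. Qed.

Lemma uea_ideal_closed : zmod_closed uea_ideal.
Proof.
split=> [|u v /uea_idealP Iu /uea_idealP Iv]; apply/uea_idealP; first exact: IdealSpan0.
by apply: IdealSpanD Iu _; apply: ideal_spanN.
Qed.

HB.instance Definition _ := GRing.isZmodClosed.Build lie_free uea_ideal uea_ideal_closed.

Lemma uea_idealMM (u a b : lie_free) : u \in uea_ideal -> a * u * b \in uea_ideal.
Proof. by move=> /uea_idealP Iu; apply/uea_idealP/ideal_spanMM. Qed.

Lemma uea_idealMl (u a : lie_free) : u \in uea_ideal -> a * u \in uea_ideal.
Proof. by move=> Iu; rewrite -[a * u]mulr1 uea_idealMM. Qed.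

Lemma uea_idealMr (u b : lie_free) : u \in uea_ideal -> u * b \in uea_ideal.
Proof. by move=> Iu; rewrite -[u]mul1r uea_idealMM. Qed.

Lemma uea_ideal1 : 1 \notin uea_ideal.
Proof.
apply/negP => /uea_idealP I1; have/eqP := oner_neq0 k; apply.
pose aug : {rmorphism lie_free -> k} := @mcoeff {fmonom L} k mone.
have gen0 x : aug (lie_gen x) = 0.
  by rewrite /aug /= /lie_gen mcoeffU fm1_eq1 mulr0n.
have augZ c u : aug (c *: u) = c * aug u by apply: mcoeffZ.
have augM0 u v : aug u = 0 -> aug (u * v) = 0 by move=> u0; rewrite rmorphM u0 mul0r.
have augB0 u v : aug u = 0 -> aug v = 0 -> aug (u - v) = 0.
  by move=> u0 v0; rewrite rmorphB u0 v0 subrr.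
suff aug0 u : ideal_span uea_rel u -> aug u = 0 by rewrite -(rmorph1 aug) aug0.
elim=> [|{}u v _ u0 _ v0|a r b Pr]; first exact: rmorph0.
  by rewrite rmorphD u0 v0 addr0.
rewrite !rmorphM; suff -> : aug r = 0 by rewrite mulr0 mul0r.
case: Pr => [c x y|x y].
  by rewrite rmorphB rmorphD augZ !gen0 mulr0 addr0 subr0.
by apply: (augB0 _ _ _ (gen0 _)); apply: augB0; apply: augM0.
Qed.

Definition uea := {ideal_quot uea_ideal}.
HB.instance Definition _ := Choice.on uea.
HB.instance Definition _ := GRing.Zmodule.on uea.
HB.instance Definition _ := EqQuotient.on uea.

Definition uea_pi (u : lie_free) : uea := \pi_uea u.

Lemma uea_piE u v : (uea_pi u = uea_pi v) <-> (u - v \in uea_ideal).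
Proof. by rewrite (Quotient.idealrBE uea_ideal); split=> /eqP. Qed.

Lemma uea_reprK x : uea_pi (repr x) = x.
Proof. exact: reprK. Qed.

Lemma uea_pi_surj x : exists u, x = uea_pi u.
Proof. by exists (repr x); rewrite uea_reprK. Qed.

Lemma uea_piB : zmod_morphism uea_pi.
Proof.
by move=> u v; rewrite /uea_pi; apply: (@pi_is_zmod_morphism _ _ _ (Quotient.quot uea_ideal)).
Qed.
HB.instance Definition _ := GRing.isZmodMorphism.Build lie_free uea uea_pi uea_piB.

Lemma uea_repr_pi u : repr (uea_pi u) - u \in uea_ideal.
Proof. by apply/uea_piE; rewrite uea_reprK. Qed.

Definition uea_mul (x y : uea) : uea := uea_pi (repr x * repr y).
Definition uea_scale (c : k) (x : uea) : uea := uea_pi (c *: repr x).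

Lemma uea_pi_mul u v : uea_mul (uea_pi u) (uea_pi v) = uea_pi (u * v).
Proof.
apply/uea_piE; set u' := repr _; set v' := repr _.
have -> : u' * v' - u * v = (u' - u) * v' + u * (v' - v).
  by rewrite mulrBl mulrBr addrA subrK.
by apply: rpredD; [apply: uea_idealMr | apply: uea_idealMl]; apply: uea_repr_pi.
Qed.

Lemma lie_free_scale c (u : lie_free) : c *: u = c *: (1 : lie_free) * u.
Proof. by rewrite -scalerAl mul1r. Qed.

Lemma uea_pi_scale c u : uea_scale c (uea_pi u) = uea_pi (c *: u).
Proof.
by apply/uea_piE; rewrite -scalerBr lie_free_scale; apply/uea_idealMl/uea_repr_pi.
Qed.

Lemma uea_mulA : associative uea_mul.
Proof.
move=> x y z; have [[[u ->] [v ->]] [w ->]] := (uea_pi_surj x, uea_pi_surj y, uea_pi_surj z).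
by rewrite !uea_pi_mul mulrA.
Qed.

Lemma uea_mul1 : left_id (uea_pi 1) uea_mul.
Proof. by move=> x; have [u ->] := uea_pi_surj x; rewrite uea_pi_mul mul1r. Qed.

Lemma uea_mulr1 : right_id (uea_pi 1) uea_mul.
Proof. by move=> x; have [u ->] := uea_pi_surj x; rewrite uea_pi_mul mulr1. Qed.

Lemma uea_mulDl : left_distributive uea_mul +%R.
Proof.
move=> x y z; have [[[u ->] [v ->]] [w ->]] := (uea_pi_surj x, uea_pi_surj y, uea_pi_surj z).
by rewrite -raddfD !uea_pi_mul mulrDl raddfD.
Qed.

Lemma uea_mulDr : right_distributive uea_mul +%R.
Proof.
move=> x y z; have [[[u ->] [v ->]] [w ->]] := (uea_pi_surj x, uea_pi_surj y, uea_pi_surj z).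
by rewrite -raddfD !uea_pi_mul mulrDr raddfD.
Qed.

Lemma uea_oner_neq0 : uea_pi 1 != 0.
Proof.
apply/eqP; rewrite -(raddf0 uea_pi) => /uea_piE.
by rewrite subr0 (negPf uea_ideal1).
Qed.

HB.instance Definition _ := GRing.Zmodule_isNzRing.Build uea
  uea_mulA uea_mul1 uea_mulr1 uea_mulDl uea_mulDr uea_oner_neq0.

Lemma uea_scaleA a b x : uea_scale a (uea_scale b x) = uea_scale (a * b) x.
Proof. by have [u ->] := uea_pi_surj x; rewrite !uea_pi_scale scalerA. Qed.

Lemma uea_scale1 : left_id 1 uea_scale.
Proof. by move=> x; have [u ->] := uea_pi_surj x; rewrite uea_pi_scale scale1r. Qed.

Lemma uea_scaleDr : right_distributive uea_scale +%R.
Proof.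
move=> c x y; have [[u ->] [v ->]] := (uea_pi_surj x, uea_pi_surj y).
by rewrite -raddfD !uea_pi_scale scalerDr raddfD.
Qed.

Lemma uea_scaleDl x : {morph uea_scale^~ x : a b / a + b}.
Proof.
move=> a b; have [u ->] := uea_pi_surj x.
by rewrite !uea_pi_scale scalerDl raddfD.
Qed.

HB.instance Definition _ := GRing.Zmodule_isLmodule.Build k uea
  uea_scaleA uea_scale1 uea_scaleDr uea_scaleDl.

Lemma uea_scaleAl c (x y : uea) : c *: (x * y) = (c *: x) * y.
Proof.
have [[u ->] [v ->]] := (uea_pi_surj x, uea_pi_surj y).
by rewrite /GRing.scale/= [in LHS]/GRing.mul [in RHS]/GRing.mul/= !(uea_pi_mul, uea_pi_scale) scalerAl.
Qed.

HB.instance Definition _ := GRing.Lmodule_isLalgebra.Build k uea uea_scaleAl.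

Lemma lie_free_malgC c (u : lie_free) : malgC c * u = u * malgC c.
Proof.
rewrite !malgM_def fgmulUg fgmulgU; apply: eq_bigr => i _.
by rewrite mul1m mulm1 mulrC.
Qed.

Lemma lie_free_scaleAr c (u v : lie_free) : c *: (u * v) = u * (c *: v).
Proof.
by rewrite -(mul_malgC c v) mulrA -lie_free_malgC -mulrA mul_malgC.
Qed.

Lemma uea_scaleAr c (x y : uea) : c *: (x * y) = x * (c *: y).
Proof.
have [[u ->] [v ->]] := (uea_pi_surj x, uea_pi_surj y).
by rewrite /GRing.scale/= [in LHS]/GRing.mul [in RHS]/GRing.mul/= !(uea_pi_mul, uea_pi_scale) lie_free_scaleAr.
Qed.

HB.instance Definition _ := GRing.Lalgebra_isAlgebra.Build k uea uea_scaleAr.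

Definition uea_in (x : L) : uea := uea_pi (lie_gen x).

Lemma uea_in_linear : linear uea_in.
Proof.
move=> c x y; have pZ u : uea_pi (c *: u) = c *: uea_pi u by rewrite -uea_pi_scale.
rewrite -pZ -raddfD; apply/uea_piE/uea_idealP.
by rewrite -[_ - _]mul1r -[_ * _]mulr1; apply/IdealSpanM/UeaLinear.
Qed.
HB.instance Definition _ := GRing.isLinear.Build k L uea _ uea_in uea_in_linear.

Lemma uea_in_lie x y :
  uea_in (lie x y) = uea_in x * uea_in y - uea_in y * uea_in x.
Proof.
have pM u v : uea_pi (u * v) = uea_pi u * uea_pi v by rewrite -uea_pi_mul.
rewrite -!pM -raddfB; apply/esym/uea_piE/uea_idealP.
by rewrite -[_ - _]mul1r -[_ * _]mulr1; apply/IdealSpanM/UeaBracket.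
Qed.

End UniversalEnveloping.

Section Subgroup.
Variables (k : fieldType) (Gam : zmodClosed k).

Definition subgroup := {x : k | x \in Gam}.
HB.instance Definition _ := Choice.on subgroup.
HB.instance Definition _ := [isSub of subgroup for @sval k (fun x => x \in Gam)].
HB.instance Definition _ := [SubChoice_isSubZmodule of subgroup by <:].

Definition finitely_generated : Prop :=
  exists (m : nat) (s : m.-tuple k), forall x, x \in Gam <-> inIntSpan s x.

End Subgroup.

Section Witt.
Variables (k : fieldType) (Gam : zmodClosed k).
Local Notation G := (subgroup Gam).

Definition witt := {malg k[G]}.
HB.instance Definition _ := GRing.Lmodule.on witt.

Definition witt_e (mu : G) : witt := << 1 *g mu >>.


(* The bilinear extension of [e_mu, e_nu] = (nu - mu) e_(nu + mu) *)
Definition witt_lie (f g : witt) : witt :=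
  biext (fun (mu nu : G) (x y : k) =>
    << x * y * (val nu - val mu) *g (nu + mu)%R >> : witt) f g.

Let Fl (mu nu : G) (y : k) :
  zmod_morphism (fun x : k => << x * y * (val nu - val mu) *g (nu + mu)%R >> : witt).
Proof. by move=> x z; rewrite -monalgUB; congr (<< _ *g _ >>); ring. Qed.

Let Fr (mu nu : G) (x : k) :
  zmod_morphism (fun y : k => << x * y * (val nu - val mu) *g (nu + mu)%R >> : witt).
Proof. by move=> y z; rewrite -monalgUB; congr (<< _ *g _ >>); ring. Qed.

Let malgZU (c x : k) (mu : G) : c *: (<< x *g mu >> : {malg k[G]}) = << c * x *g mu >>.
Proof.
apply/malgP => i; apply: etrans (mcoeffZ _ _ _) _.
by rewrite [in LHS]mcoeffU [RHS]mcoeffU mulrnAr.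
Qed.

Lemma witt_lie_linearl g : linear (witt_lie^~ g).
Proof.
apply: (@biext_is_linearl _ _ {malg k[G]} _ Fl Fr) => mu nu c x y.
by rewrite malgZU; congr (<< _ *g _ >>); ring.
Qed.

Lemma witt_lie_linearr f : linear (witt_lie f).
Proof.
apply: (@biext_is_linearr _ _ {malg k[G]} _ Fl Fr) => mu nu c x y.
by rewrite malgZU; congr (<< _ *g _ >>); ring.
Qed.

Lemma witt_lieUU mu nu x y : witt_lie << x *g mu >> << y *g nu >> =
  << x * y * (val nu - val mu) *g (nu + mu)%R >>.
Proof. exact: biextUU Fl Fr _ _ _ _. Qed.

Let lie_additivel g : zmod_morphism (witt_lie^~ g).
Proof. exact: (biext_is_additivel Fl Fr). Qed.
Let lie_additiver f : zmod_morphism (witt_lie f).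
Proof. exact: (biext_is_additiver Fl Fr). Qed.

Let wmono (f : witt) := exists mu x, f = << x *g mu >>.

Let witt_ind (P : witt -> Prop) :
    P 0 -> (forall f g : witt, P f -> P g -> P (f + g)) ->
    (forall f, wmono f -> P f) ->
  forall f, P f.
Proof. by move=> P0 PD PU; apply: malg_ind => // i x; apply: PU; exists i, x. Qed.

Let wittDU mu x y : << x *g mu >> + << y *g mu >> = << x + y *g mu >> :> witt.
Proof. by rewrite monalgUD. Qed.

Let wittU0 mu x : x = 0 -> << x *g mu >> = 0 :> witt.
Proof. by move=> ->; apply: monalgU0. Qed.

Let lie_mono_antisym f g : wmono f -> wmono g -> witt_lie f g + witt_lie g f = 0.
Proof.
move=> [mu [x ->]] [nu [y ->]].
rewrite (witt_lieUU mu nu) (witt_lieUU nu mu) [mu + nu]addrC wittDU.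
by apply: wittU0; ring.
Qed.

Lemma witt_lie_alternating f : witt_lie f f = 0.
Proof.
apply: (gen_alternating witt_ind lie_additivel lie_additiver) => [|_ [mu [x ->]]].
  exact: lie_mono_antisym.
by rewrite witt_lieUU; apply: wittU0; rewrite subrr mulr0.
Qed.

Lemma witt_lie_jacobi f g h :
  witt_lie f (witt_lie g h) + witt_lie g (witt_lie h f) +
    witt_lie h (witt_lie f g) = 0.
Proof.
apply: (gen_jacobi witt_ind lie_additivel lie_additiver).
move=> _ _ _ [mu [x ->]] [nu [y ->]] [rho [z ->]].
have lie3 (a b c : G) (u v w : k) :
    witt_lie << u *g a >> (witt_lie << v *g b >> << w *g c >>) =
    << u * (v * w * (val c - val b)) * (val c + val b - val a) *g c + b + a >>.
  exact: etrans (congr1 (witt_lie _) (witt_lieUU _ _ _ _)) (witt_lieUU _ _ _ _).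
have sum3 (a b c : witt) (i : G) (u v w : k) :
    a = << u *g i >> -> b = << v *g i >> -> c = << w *g i >> ->
    u + v + w = 0 -> a + b + c = 0.
  by move=> -> -> -> uvw0; rewrite !wittDU uvw0; apply: wittU0.
apply: sum3 (lie3 _ _ _ _ _ _) _ _ _.
- by rewrite [rho + nu + mu]addrC addrA; apply: lie3.
- by rewrite -[rho + nu + mu]addrA [rho + _]addrC; apply: lie3.
- by ring.
Qed.

HB.instance Definition _ := Lmodule_isLieAlgebra.Build k witt
  witt_lie_linearl witt_lie_linearr witt_lie_alternating witt_lie_jacobi.

Lemma lie_witt_e mu nu :
  lie (witt_e mu) (witt_e nu) = (val nu - val mu) *: witt_e (nu + mu).
Proof.
rewrite [LHS]witt_lieUU.
by rewrite [RHS]malgZU; congr (<< _ *g _ >>); ring.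
Qed.
End Witt.

Section SkewGroupAlgebra.
Variables (k : fieldType) (Gam : zmodClosed k).
Local Notation G := (subgroup Gam).
Local Notation kab := (mpoly.mpoly 2 k).

Definition va : kab := 'X_ord0.
Definition vb : kab := 'X_ord_max.

(* p(a, b) |-> p(a + mu, b) *)
Definition shift (mu : G) (p : kab) : kab :=
  p \mPo [tuple va + (val mu)%:MP_[2]; vb].

Lemma shift_is_zmod_morphism mu : zmod_morphism (shift mu).
Proof. exact: comp_mpolyB. Qed.
HB.instance Definition _ mu :=
  GRing.isZmodMorphism.Build kab kab (shift mu) (shift_is_zmod_morphism mu).

Lemma shift_is_monoid_morphism mu : monoid_morphism (shift mu).
Proof. by split; [apply: comp_mpoly1 | move=> p q; rewrite /shift rmorphM]. Qed.
HB.instance Definition _ mu :=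
  GRing.isMonoidMorphism.Build kab kab (shift mu) (shift_is_monoid_morphism mu).

Lemma shiftC mu (c : k) : shift mu c%:MP_[2] = c%:MP_[2].
Proof. exact: comp_mpolyC. Qed.

Lemma shift_va mu : shift mu va = va + (val mu)%:MP_[2].
Proof. by rewrite /shift /va comp_mpolyXU. Qed.

Lemma shift_vb mu : shift mu vb = vb.
Proof. by rewrite /shift /vb comp_mpolyXU. Qed.

Lemma kab_morph_ext (f g : {rmorphism kab -> kab}) :
  (forall c, f c%:MP_[2] = g c%:MP_[2]) -> f va = g va -> f vb = g vb -> f =1 g.
Proof.
move=> fgC fga fgb p; rewrite [p]mpoly.mpolyE !rmorph_sum /=.
apply: eq_bigr => m _; rewrite -mul_mpolyC !rmorphM fgC; congr (_ * _).
rewrite mpolyXE_id !rmorph_prod; apply: eq_bigr => i _; rewrite !rmorphXn; congr (_ ^+ _).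
case: i => [[|[|//]] i2]; first by rewrite (_ : Ordinal i2 = ord0) //; apply: val_inj.
by rewrite (_ : Ordinal i2 = ord_max) //; apply: val_inj.
Qed.

Lemma shift0 p : shift 0 p = p.
Proof.
apply: (kab_morph_ext (f := shift 0) (g := idfun)) => [c||].
- exact: shiftC.
- by rewrite /= shift_va /= mpolyC0 addr0.
- exact: shift_vb.
Qed.

Lemma shiftD mu nu p : shift (mu + nu) p = shift mu (shift nu p).
Proof.
apply: (kab_morph_ext (f := shift (mu + nu)) (g := shift mu \o shift nu)) => [c||] /=.
- by rewrite !shiftC.
- by rewrite !shift_va (rmorphD (shift mu)) /= shift_va shiftC -addrA -mpoly.mpolyCD raddfD.
- by rewrite !shift_vb.
Qed.

Definition skew_alg := {malg kab[G]}.
HB.instance Definition _ := GRing.Zmodule.on skew_alg.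

(* p t^nu *)
Definition skew_mono (p : kab) (nu : G) : skew_alg := << p *g nu >>.

Lemma skew_mono_eq p q mu nu : p = q -> mu = nu -> skew_mono p mu = skew_mono q nu.
Proof. by move=> -> ->. Qed.

(* The biadditive extension of (p t^mu) (q t^nu) = p (t^mu q) t^nu
   = p(a, b) q(a + mu, b) t^(mu + nu) *)
Definition skew_mul (f g : skew_alg) : skew_alg :=
  biext (fun (mu nu : G) (p q : kab) => skew_mono (p * shift mu q) (mu + nu)) f g.

Let Fl (mu nu : G) (q : kab) :
  zmod_morphism (fun p => skew_mono (p * shift mu q) (mu + nu)).
Proof. by move=> p1 p2; rewrite mulrBl /skew_mono monalgUB. Qed.

Let Fr (mu nu : G) (p : kab) :
  zmod_morphism (fun q => skew_mono (p * shift mu q) (mu + nu)).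
Proof. by move=> q1 q2; rewrite rmorphB mulrBr /skew_mono monalgUB. Qed.

Lemma skew_mulUU p q mu nu :
  skew_mul (skew_mono p mu) (skew_mono q nu) = skew_mono (p * shift mu q) (mu + nu).
Proof. exact: biextUU Fl Fr _ _ _ _. Qed.

Lemma skew_mulDl : left_distributive skew_mul +%R.
Proof. by move=> f g h; apply: (biextDl Fl). Qed.
Lemma skew_mulDr : right_distributive skew_mul +%R.
Proof. by move=> f g h; apply: (biextDr Fl Fr). Qed.
Let mul0l f : skew_mul 0 f = 0.
Proof. exact: (biext0l Fl). Qed.
Let mul0r' f : skew_mul f 0 = 0.
Proof. exact: (biext0r Fl Fr). Qed.

Let smono (f : skew_alg) := exists p mu, f = skew_mono p mu.

Let skew_mono_ind (P : skew_alg -> Prop) :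
    P 0 -> (forall f g : skew_alg, P f -> P g -> P (f + g)) ->
    (forall f, smono f -> P f) ->
  forall f, P f.
Proof. by move=> P0 PD PU; apply: malg_ind => // i x; apply: PU; exists x, i. Qed.

Lemma skew_ind (P : skew_alg -> Prop) :
    P 0 -> (forall f g : skew_alg, P f -> P g -> P (f + g)) ->
    (forall p mu, P (skew_mono p mu)) ->
  forall f, P f.
Proof. by move=> P0 PD PU; apply: malg_ind => // i x; apply: PU. Qed.

Definition skew_one : skew_alg := skew_mono 1 0.

Lemma skew_mulA : associative skew_mul.
Proof.
have mul_additivel g : zmod_morphism (skew_mul^~ g) by apply: (biext_is_additivel Fl Fr).
have mul_additiver f : zmod_morphism (skew_mul f) by apply: (biext_is_additiver Fl Fr).
apply: (gen_associative skew_mono_ind mul_additivel mul_additiver).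
move=> _ _ _ [p [mu ->]] [q [nu ->]] [r [rho ->]].
apply: etrans (congr1 (skew_mul _) (skew_mulUU _ _ _ _)) _.
apply: etrans (skew_mulUU _ _ _ _) _.
apply: etrans (esym (congr1 (skew_mul^~ _) (skew_mulUU _ _ _ _))).
apply: etrans (esym (skew_mulUU _ _ _ _)).
by apply: skew_mono_eq; [rewrite (rmorphM (shift mu)) mulrA shiftD | apply: addrA].
Qed.

Lemma skew_mul1 : left_id skew_one skew_mul.
Proof.
move=> f; elim/skew_ind: f => [|f1 f2 IH1 IH2|p mu]; first exact: mul0r'.
  by rewrite skew_mulDr IH1 IH2.
by rewrite skew_mulUU shift0 mul1r add0r.
Qed.

Lemma skew_mulr1 : right_id skew_one skew_mul.
Proof.
move=> f; elim/skew_ind: f => [|f1 f2 IH1 IH2|p mu]; first exact: mul0l.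
  by rewrite skew_mulDl IH1 IH2.
by rewrite skew_mulUU rmorph1 mulr1 addr0.
Qed.

Lemma skew_one_neq0 : skew_one != 0.
Proof. by rewrite monalgU_eq0 oner_eq0. Qed.

HB.instance Definition _ := GRing.Zmodule_isNzRing.Build skew_alg
  skew_mulA skew_mul1 skew_mulr1 skew_mulDl skew_mulDr skew_one_neq0.

Definition skew_scale (c : k) (f : skew_alg) : skew_alg := skew_mul (skew_mono c%:MP_[2] 0) f.

Lemma skew_scaleU c p mu : skew_scale c (skew_mono p mu) = skew_mono (c *: p) mu.
Proof. by rewrite /skew_scale skew_mulUU shift0 add0r mul_mpolyC. Qed.

Lemma skew_scaleA a b f : skew_scale a (skew_scale b f) = skew_scale (a * b) f.
Proof.
apply: etrans (skew_mulA _ _ _) _; apply: (congr1 (skew_mul^~ f)).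
apply: etrans (skew_mulUU _ _ _ _) _; apply: skew_mono_eq; last exact: addr0.
by rewrite shiftC mpoly.mpolyCM.
Qed.

Lemma skew_scale1 : left_id 1 skew_scale.
Proof. by move=> f; rewrite /skew_scale mpolyC1; apply: skew_mul1. Qed.

Lemma skew_scaleDr : right_distributive skew_scale +%R.
Proof. by move=> c f g; apply: skew_mulDr. Qed.

Lemma skew_scaleDl f : {morph skew_scale^~ f : a b / a + b}.
Proof.
by move=> a b; rewrite -skew_mulDl; congr skew_mul; rewrite mpoly.mpolyCD /skew_mono monalgUD.
Qed.

HB.instance Definition _ := GRing.Zmodule_isLmodule.Build k skew_alg
  skew_scaleA skew_scale1 skew_scaleDr skew_scaleDl.

Lemma skew_scaleAl c (f g : skew_alg) : c *: (f * g) = (c *: f) * g.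
Proof. exact: skew_mulA. Qed.
HB.instance Definition _ := GRing.Lmodule_isLalgebra.Build k skew_alg skew_scaleAl.

Lemma skew_mulC c f :
  skew_mul (skew_mono c%:MP_[2] 0) f = skew_mul f (skew_mono c%:MP_[2] 0).
Proof.
elim/skew_ind: f => [|f1 f2 IH1 IH2|p mu].
- exact: etrans (mul0r' _) (esym (mul0l _)).
- apply: etrans (skew_mulDr _ _ _) _; apply: etrans (esym (skew_mulDl _ _ _)).
  by rewrite IH1 IH2.
- apply: etrans (skew_mulUU _ _ _ _) _; apply: etrans (esym (skew_mulUU _ _ _ _)).
  apply: skew_mono_eq; last exact: etrans (add0r _) (esym (addr0 _)).
  by rewrite shift0 shiftC mulrC.
Qed.

Lemma skew_scaleAr c (f g : skew_alg) : c *: (f * g) = f * (c *: g).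
Proof.
apply: etrans (skew_mulA _ _ _) _; apply: etrans (esym (skew_mulA _ _ _)).
exact/(congr1 (skew_mul^~ g))/skew_mulC.
Qed.
HB.instance Definition _ := GRing.Lalgebra_isAlgebra.Build k skew_alg skew_scaleAr.

Lemma skew_monoM p q mu nu :
  skew_mono p mu * skew_mono q nu = skew_mono (p * shift mu q) (mu + nu).
Proof. exact: skew_mulUU. Qed.

Lemma skew_monoZ c p mu : c *: skew_mono p mu = skew_mono (c *: p) mu.
Proof. exact: skew_scaleU. Qed.

Definition skew_t (nu : G) : skew_alg := skew_mono 1 nu.
Definition skew_poly (p : kab) : skew_alg := skew_mono p 0.

Lemma skew_monoE p nu : skew_mono p nu = skew_poly p * skew_t nu.
Proof. by rewrite skew_monoM rmorph1 mulr1 add0r. Qed.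

Lemma skew_tM mu nu : skew_t mu * skew_t nu = skew_t (mu + nu).
Proof. by rewrite skew_monoM rmorph1 mulr1. Qed.

Lemma skew_t_poly nu p : skew_t nu * skew_poly p = skew_poly (shift nu p) * skew_t nu.
Proof. apply: etrans (skew_monoM _ _ _ _) _; apply: etrans (skew_monoE _ _).
by apply: skew_mono_eq; [apply: mul1r | apply: addr0]. Qed.

End SkewGroupAlgebra.

Section Phi.
Variables (k : fieldType) (Gam : zmodClosed k).
Local Notation G := (subgroup Gam).

(* The linear extension of e_mu |-> (a + b mu) t^mu *)
Definition witt_phi (w : witt Gam) : skew_alg Gam :=
  \sum_(mu <- msupp w) w@_mu *: skew_mono (va k + val mu *: vb k) mu.

Lemma witt_phi_w (d : {fset G}) (w : witt Gam) : (msupp w `<=` d)%fset ->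
  witt_phi w = \sum_(mu <- d) w@_mu *: skew_mono (va k + val mu *: vb k) mu.
Proof.
move=> wd; rewrite /witt_phi (big_fset_incl _ wd) //= => mu _ /mcoeff_outdom ->.
exact: scale0r.
Qed.

Lemma witt_phi_linear : linear witt_phi.
Proof.
move=> c v w; set d := (msupp v `|` msupp w)%fset.
have dv : (msupp v `<=` d)%fset by apply: fsubsetUl.
have dw : (msupp w `<=` d)%fset by apply: fsubsetUr.
have dcv : (msupp ((c *: v + w)%R : witt Gam) `<=` d)%fset.
  apply: fsubset_trans (msuppD_le _ _) _.
  by rewrite fsetSU // msuppZ_le.
rewrite (witt_phi_w dv) (witt_phi_w dw) (witt_phi_w dcv) scaler_sumr -big_split.
by apply: eq_bigr => mu _; rewrite mcoeffD mcoeffZ scalerDl scalerA.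
Qed.
HB.instance Definition _ := GRing.isLinear.Build k (witt Gam) (skew_alg Gam) _
  witt_phi witt_phi_linear.

Lemma witt_phi_e mu : witt_phi (witt_e mu) = skew_mono (va k + val mu *: vb k) mu.
Proof.
by rewrite (witt_phi_w msuppU_le) big_seq_fset1 mcoeffUU scale1r.
Qed.
End Phi.

Definition anti_algebra_morphism (k : fieldType) (A B : algType k) (f : A -> B) : Prop :=
  [/\ linear f, f 1 = 1 & {morph f : u v / u * v >-> v * u}].

(* [act] makes the vector space V a left A-module; the last clause says that
   the scalars k <= A act on V by the given scalar multiplication. *)
Definition left_module_law (k : fieldType) (A : algType k) (V : lmodType k)
    (act : A -> V -> V) : Prop :=
  [/\ forall u v x, act u (act v x) = act (u * v) x,
      forall x, act 1 x = x,
      forall u x y, act u (x + y) = act u x + act u y,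
      forall u v x, act (u + v) x = act u x + act v x
    & forall c u x, act (c *: u) x = c *: act u x].

(* Main.v *)
(* Since phi [v, w] = phi w * phi v - phi v * phi w in T, the anti-multiplicative
   extension of phi to the free algebra, sending a word x_1 ... x_n to
   phi x_n * ... * phi x_1, kills the defining relations of U(W) and so factors
   through it.  As it reverses products, right multiplication by its values
   is a left action.  On basis vectors the identity is
   (a + b nu)(a + nu + b mu) - (a + b mu)(a + mu + b nu)
     = (nu - mu)(a + b (mu + nu)). *)
Require Import Defs.
From HB Require Import structures.
From mathcomp Require Import all_boot all_order all_algebra.
From mathcomp.multinomials Require Import mpoly monalg.
From mathcomp Require Import ring.

Import GRing.Theory.
Local Open Scope ring_scope.

(** * Scaled monomials, and modules obtained from anti-homomorphisms *)

Lemma malgZU (K : choiceType) (R : nzRingType) (c x : R) (i : K) :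
  c *: << x *g i >> = << c * x *g i >> :> {malg R[K]}.
Proof. by apply/malgP => j; rewrite mcoeffZ !mcoeffU mulrnAr. Qed.

Lemma anti_algebra_morphism_module_law (k : fieldType) (A B : algType k)
    (f : A -> B) :
  anti_algebra_morphism f -> left_module_law (fun u (x : B) => x * f u).
Proof.
move=> [fL f1 fM].
(* The scalar -1 turns the single identity of [linear] into [f 0 = - f 0 + f 0]. *)
have f0 : f 0 = 0 by have := fL (-1) 0 0; rewrite scaler0 addr0 scaleN1r addNr.
split=> [u v x|x|u x y|u v x|c u x].
- by rewrite fM mulrA.
- by rewrite f1 mulr1.
- by rewrite mulrDl.
- by rewrite -[u]scale1r fL !scale1r mulrDr.
- by rewrite -[c *: u]addr0 fL f0 addr0 scalerAr.
Qed.

(** * Universal property of U(L) for anti-homomorphisms *)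

Section AntiUniversalProperty.
Variables (k : fieldType) (L : lieAlgType k) (A : algType k).
Local Notation lie_free := {malg k[{fmonom L}]}.

Lemma uea_piD u v : uea_pi (u + v) = uea_pi u + uea_pi v :> uea L.
Proof. exact: raddfD. Qed.

Lemma uea_piM u v : uea_pi (u * v) = uea_pi u * uea_pi v :> uea L.
Proof. by rewrite -uea_pi_mul. Qed.

Lemma uea_piZ c u : uea_pi (c *: u) = c *: uea_pi u :> uea L.
Proof. by rewrite -uea_pi_scale. Qed.

(** U(L) is spanned by the classes of words in L, and a word is built from 1 by adding letters on
    the left. This yields the uniqueness of the lift. *)
Lemma uea_ind (P : uea L -> Prop) :
    P 1 -> (forall x u, P u -> P (uea_in x * u)) ->
    (forall c u v, P u -> P v -> P (c *: u + v)) ->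
  forall u, P u.
Proof.
move=> P1 PM PL u; have [{}u ->] := uea_pi_surj u.
have P0 : P 0 by have := PL (-1) 1 1 P1 P1; rewrite scaleN1r addNr.
elim/malg_ind: u => [|u v Pu Pv|m c]; first by rewrite raddf0.
  by rewrite uea_piD -[uea_pi u]scale1r; apply: PL.
(* The coefficient is pulled out as a scalar, which leaves a bare word for the induction on
   letters. *)
rewrite -[c]mulr1 -malgZU uea_piZ -[_ *: _]addr0; apply: PL => //.
case: m => s; elim: s => [|x s IHs]; first by rewrite -fmoneE.
have -> : << FMonom (x :: s) >> = lie_gen x * << FMonom s >> :> lie_free.
  rewrite malgM_def fgmulUU mulr1; congr << _ >>.
  by apply/eqP; rewrite fmP fmM fmU.
by rewrite uea_piM; apply: PM.
Qed.

Lemma anti_algebra_morphism_uea_ext (f g : uea L -> A) :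
    anti_algebra_morphism f -> anti_algebra_morphism g ->
    (forall x, f (uea_in x) = g (uea_in x)) ->
  f =1 g.
Proof.
move=> [fL f1 fM] [gL g1 gM] fg; elim/uea_ind => [|x u IHu|c u v IHu IHv].
- by rewrite f1 g1.
- by rewrite fM gM IHu fg.
- by rewrite fL gL IHu IHv.
Qed.

Variable phi : L -> A.
Hypothesis phi_linear : linear phi.
Hypothesis phi_lie : forall x y, phi (lie x y) = phi y * phi x - phi x * phi y.

Definition word_anti_eval (m : {fmonom L}) : A := \prod_(x <- rev m) phi x.

Lemma word_anti_evalM m n :
  word_anti_eval (mmul m n) = word_anti_eval n * word_anti_eval m.
Proof. by rewrite /word_anti_eval fmM rev_cat big_cat. Qed.

(** Coefficients enter A through its structure map [in_alg A], whose image is central. *)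
Definition free_anti_eval (u : lie_free) : A :=
  mmap (in_alg A) word_anti_eval u.

Lemma free_anti_evalB : zmod_morphism free_anti_eval.
Proof. exact: mmapB. Qed.
HB.instance Definition _ :=
  GRing.isZmodMorphism.Build lie_free A free_anti_eval free_anti_evalB.

Lemma free_anti_eval0 : free_anti_eval 0 = 0.
Proof. exact: raddf0. Qed.

Lemma free_anti_evalD u v :
  free_anti_eval (u + v) = free_anti_eval u + free_anti_eval v.
Proof. exact: raddfD. Qed.

Lemma free_anti_evalU c m : free_anti_eval << c *g m >> = c *: word_anti_eval m.
Proof. by rewrite /free_anti_eval mmapU /= mulr_algl. Qed.

Lemma free_anti_eval_gen x : free_anti_eval (lie_gen x) = phi x.
Proof. by rewrite free_anti_evalU scale1r /word_anti_eval fmU big_seq1. Qed.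

Lemma free_anti_evalZ c u : free_anti_eval (c *: u) = c *: free_anti_eval u.
Proof.
elim/malg_ind: u => [|u v IHu IHv|m d].
- by rewrite scaler0 free_anti_eval0 scaler0.
- by rewrite scalerDr !free_anti_evalD scalerDr; congr (_ + _).
- by rewrite malgZU free_anti_evalU -scalerA -free_anti_evalU.
Qed.

Lemma free_anti_eval1 : free_anti_eval 1 = 1.
Proof. by rewrite free_anti_evalU scale1r /word_anti_eval fm1 big_nil. Qed.

(** By biadditivity it is enough to compare monomials. There [word_anti_evalM] reverses the words,
    and the coefficients, reversed too, commute in k. *)
Lemma free_anti_evalM u v :
  free_anti_eval (u * v) = free_anti_eval v * free_anti_eval u.
Proof.
elim/malg_ind: u => [|u1 u2 IH1 IH2|m c].
- by rewrite mul0r free_anti_eval0 mulr0.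
- by rewrite mulrDl !free_anti_evalD mulrDr; congr (_ + _).
elim/malg_ind: v => [|v1 v2 IH1 IH2|n d].
- by rewrite mulr0 free_anti_eval0 mul0r.
- by rewrite mulrDr !free_anti_evalD mulrDl; congr (_ + _).
by rewrite malgM_def fgmulUU !free_anti_evalU word_anti_evalM -scalerAl
  -scalerAr scalerA mulrC.
Qed.

Lemma free_anti_eval_ideal (u : lie_free) : u \in @uea_ideal k L -> free_anti_eval u = 0.
Proof.
move=> /uea_idealP; elim=> [|{}u v _ u0 _ v0|a r b Pr].
- exact: free_anti_eval0.
- by rewrite free_anti_evalD u0 v0 addr0.
(* The value of [r] is a factor of the value of [a * r * b], so only the defining relations matter:
   [phi_linear] handles the first family, [phi_lie] the second. *)
rewrite !free_anti_evalM; suff -> : free_anti_eval r = 0 by rewrite mul0r mulr0.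
case: Pr => [c x y|x y]; rewrite !free_anti_evalB.
- by rewrite free_anti_evalD free_anti_evalZ !free_anti_eval_gen phi_linear subrr.
- have evalM2 z t : free_anti_eval (lie_gen z * lie_gen t) = phi t * phi z.
    by rewrite free_anti_evalM !free_anti_eval_gen.
  transitivity (phi y * phi x - phi x * phi y - phi (lie x y)).
    by congr (_ - _ - _); [apply: evalM2..|apply: free_anti_eval_gen].
  by rewrite phi_lie subrr.
Qed.

Definition uea_anti_lift (u : uea L) : A := free_anti_eval (repr u).

(** The chosen representative differs from [u] by an element of the ideal, where the evaluation
    vanishes. *)
Lemma uea_anti_lift_pi u : uea_anti_lift (uea_pi u) = free_anti_eval u.
Proof.
apply/eqP; rewrite -subr_eq0 -free_anti_evalB; apply/eqP.
exact/free_anti_eval_ideal/uea_repr_pi.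
Qed.

Lemma uea_anti_lift_in x : uea_anti_lift (uea_in x) = phi x.
Proof. by rewrite uea_anti_lift_pi free_anti_eval_gen. Qed.

Lemma uea_anti_lift_morphism : anti_algebra_morphism uea_anti_lift.
Proof.
split=> [c u v||u v].
- have [[{}u ->] [{}v ->]] := (uea_pi_surj u, uea_pi_surj v).
  by rewrite -uea_piZ -uea_piD !uea_anti_lift_pi free_anti_evalD free_anti_evalZ.
- by rewrite [1]/(uea_pi 1) uea_anti_lift_pi free_anti_eval1.
- have [[{}u ->] [{}v ->]] := (uea_pi_surj u, uea_pi_surj v).
  by rewrite -uea_piM !uea_anti_lift_pi free_anti_evalM.
Qed.

End AntiUniversalProperty.

(** * The map phi reverses brackets *)

Section WittPhi.
Variables (k : fieldType) (Gam : zmodClosed k).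

Lemma witt_ind (P : witt Gam -> Prop) :
    P 0 -> (forall c v w, P v -> P w -> P (c *: v + w)) ->
    (forall mu, P (witt_e mu)) ->
  forall w, P w.
Proof.
move=> P0 PL Pe; apply: malg_ind => [|v w Pv Pw|mu c] //.
  by rewrite -[v]scale1r; apply: PL.
by rewrite -[c]mulr1 -malgZU -[_ *: _]addr0; apply: PL => //; apply: Pe.
Qed.

Lemma witt_phi_lie_e (mu nu : subgroup Gam) :
  witt_phi (lie (witt_e mu) (witt_e nu)) =
  witt_phi (witt_e nu) * witt_phi (witt_e mu)
    - witt_phi (witt_e mu) * witt_phi (witt_e nu).
Proof.
rewrite lie_witt_e linearZ /= !witt_phi_e skew_monoZ !skew_monoM.
(* Both products have the same exponent, so their difference is one monomial and only the polynomial
   coefficients remain to be compared. *)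
rewrite [mu + nu]addrC -monalgUB; apply: skew_mono_eq => //.
rewrite -!mul_mpolyC !rmorphD !rmorphM /= !shiftC !shift_va !shift_vb.
by rewrite mpolyCN; ring.
Qed.

(** Both sides are bilinear, as [commL] and [commR] record for commutators, so the case of basis
    vectors suffices. *)
Lemma witt_phi_lie (v w : witt Gam) :
  witt_phi (lie v w) = witt_phi w * witt_phi v - witt_phi v * witt_phi w.
Proof.
have commL c (x y z : skew_alg Gam) :
    (c *: x + y) * z - z * (c *: x + y)
    = c *: (x * z - z * x) + (y * z - z * y).
  by rewrite mulrDl mulrDr -scalerAl -scalerAr scalerBr opprD addrACA.
have commR c (x y z : skew_alg Gam) :
    z * (c *: x + y) - (c *: x + y) * z
    = c *: (z * x - x * z) + (z * y - y * z).
  by rewrite mulrDl mulrDr -scalerAl -scalerAr scalerBr opprD addrACA.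
elim/witt_ind: v => [|c v1 v2 IH1 IH2|mu].
- have -> : lie 0 w = 0.
    by have := lie_linearl w (-1) 0 0; rewrite scaler0 addr0 scaleN1r addNr.
  by rewrite linear0 mulr0 mul0r subrr.
- by rewrite lie_linearl !witt_phi_linear IH1 IH2 commR.
elim/witt_ind: w => [|c w1 w2 IH1 IH2|nu].
- have -> : lie (witt_e mu) 0 = 0.
    by have := lie_linearr (witt_e mu) (-1) 0 0; rewrite scaler0 addr0 scaleN1r addNr.
  by rewrite linear0 mulr0 mul0r subrr.
- by rewrite lie_linearr !witt_phi_linear IH1 IH2 commL.
exact: witt_phi_lie_e.
Qed.
End WittPhi.

(** * The anti-homomorphism and its module structure *)

Theorem proposition3p3 (k : closedFieldType) (k_char0 : [pchar k] =i pred0)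
    (Gam : zmodClosed k) (Gam_fg : finitely_generated Gam) :
  exists Phi : uea (witt Gam) -> skew_alg Gam,
    [/\ anti_algebra_morphism Phi,
        forall w : witt Gam, Phi (uea_in w) = witt_phi w,
        forall Psi : uea (witt Gam) -> skew_alg Gam,
          anti_algebra_morphism Psi ->
          (forall w : witt Gam, Psi (uea_in w) = witt_phi w) -> Psi =1 Phi
      & exists act : uea (witt Gam) -> skew_alg Gam -> skew_alg Gam,
          [/\ left_module_law act,
              forall u x, act u x = x * Phi u
            & forall (mu nu : subgroup Gam) (p : mpoly.mpoly 2 k),
                act (uea_in (witt_e mu)) (skew_mono p nu) =
                skew_mono ((va k + (val nu)%:MP_[2] + val mu *: vb k) * p)
                          (mu + nu)]].
Proof.
have lift_in := uea_anti_lift_in k _ _ _ (@witt_phi_linear k Gam) (witt_phi_lie k Gam).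
have lift_anti := uea_anti_lift_morphism k _ _ _
  (@witt_phi_linear k Gam) (witt_phi_lie k Gam).
exists (uea_anti_lift k _ _ (@witt_phi k Gam)); split=> // [Psi PsiA Psi_in|].
  by apply: anti_algebra_morphism_uea_ext => // w; rewrite Psi_in lift_in.
exists (fun u x => x * uea_anti_lift k _ _ (@witt_phi k Gam) u).
split=> [|u x|mu nu p]; first exact: anti_algebra_morphism_module_law lift_anti.
  by [].
(* Moving [t^nu] to the right past [a + b mu] replaces [a] by [a + nu], which is the source of the
   summand [nu]. *)
rewrite lift_in witt_phi_e skew_monoM; apply: skew_mono_eq; last exact: addrC.
by rewrite mulrC -mul_mpolyC rmorphD rmorphM /= shiftC shift_va shift_vb.
Qed.
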